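(* The linear map $$\Theta:(\mathcal{H}_{\mathbf{G}},m,\Delta)\longrightarrow(\mathcal{H}_{\mathbf{G}_o},m,\Delta),\qquad \Theta(G)=\sum_{H\in \mathcal{O}(G)} H\quad (G\in\mathbf{G}),$$ where $\mathcal{O}(G)$ is the set of orientations of $G$, is a bialgebra morphism.
   Context: $\mathbb{K}$ is a commutative field of characteristic $0$. Graphs are finite and simple: $G=(V(G),E(G))$ with $E(G)$ a set of unordered pairs of distinct vertices; the empty graph is allowed. $\mathbf{G}$ is the set of isoclasses of graphs; $\mathcal{H}_{\mathbf{G}}$ is the $\mathbb{K}$-vector space with basis $\mathbf{G}$, with product $m$ the disjoint union (unit: the empty graph $1$) and coproduct $\Delta(G)=\sum_{I\subseteq V(G)} G_{\mid I}\otimes G_{\mid V(G)\setminus I}$, where $G_{\mid I}$ is the induced subgraph; the counit is $\varepsilon_\Delta(G)=1$ if $G$ is empty, $0$ otherwise. An oriented graph is a pair $G=(V(G),A(G))$ with $V(G)$ a finite set and $A(G)$ a set of ordered pairs of distinct elements of $V(G)$ (arcs). $\mathbf{G}_o$ is the set of isoclasses of oriented graphs; $\mathcal{H}_{\mathbf{G}_o}$ is the $\mathbb{K}$-vector space with basis $\mathbf{G}_o$, with product $m$ the disjoint union. For $I\subseteq V(G)$, $G_{\mid I}$ has vertex set $I$ and arcs those $(x,y)\in A(G)$ with $x,y\in I$. $I\subseteq V(G)$ is an ideal of $G$ if $x\in I$ and $(x,y)\in A(G)$ imply $y\in I$. The coproduct is $\Delta(G)=\sum_{I\text{ ideal of }G}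 G_{\mid I}\otimes G_{\mid V(G)\setminus I}$, with counit $\varepsilon_\Delta(G)=1$ if $G$ is empty, $0$ otherwise. Both are bialgebras. An orientation of a simple graph $G$ is an oriented graph with vertex set $V(G)$ obtained by choosing, for each edge $\{u,v\}\in E(G)$, exactly one of the arcs $(u,v)$, $(v,u)$. Thus $|\mathcal{O}(G)|=2^{|E(G)|}$, and the sum defining $\Theta(G)$ runs over orientations as labelled objects. *)

(* Defs.v *)
From HB Require Import structures.
From mathcomp Require Import all_boot all_order all_algebra.
From mathcomp Require Import finmap monalg.

Set Implicit Arguments.
Unset Strict Implicit.
Unset Printing Implicit Defensive.

Import GRing.Theory.

Local Open Scope quotient_scope.
Local Open Scope ring_scope.


Section RelIso.
Implicit Types V W X : finType.

Definition riso V W (r : rel V) (s : rel W) : bool :=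
  [exists f : {ffun V -> W},
     [&& injectiveb f, #|V| == #|W| & [forall u, forall v, s (f u) (f v) == r u v]]].

Lemma risoP V W (r : rel V) (s : rel W) :
  reflect (exists2 f : V -> W, bijective f & forall u v, s (f u) (f v) = r u v)
          (riso r s).
Proof.
apply: (iffP existsP) => [[f /and3P[/injectiveP fI /eqP cVW /forallP fE]]|[f fB fE]].
  exists f; first by apply: inj_card_bij fI _; rewrite cVW.
  by move=> u v; move/forallP: (fE u) => /(_ v) /eqP.
exists [ffun x => f x]; apply/and3P; split.
- by apply/injectiveP => x y; rewrite !ffunE; apply: bij_inj.
- by rewrite (bij_eq_card fB).
- by apply/forallP => u; apply/forallP => v; rewrite !ffunE fE.
Qed.

Lemma riso_refl V (r : rel V) : riso r r.
Proof. by apply/risoP; exists id => //; exists id. Qed.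

Lemma riso_symW V W (r : rel V) (s : rel W) : riso r s -> riso s r.
Proof.
case/risoP => f [g fK gK] fE; apply/risoP; exists g; first by exists f.
by move=> u v; rewrite -fE !gK.
Qed.

Lemma riso_sym V W (r : rel V) (s : rel W) : riso r s = riso s r.
Proof. by apply/idP/idP; apply: riso_symW. Qed.

Lemma riso_trans V W X (r : rel V) (s : rel W) (t : rel X) :
  riso r s -> riso s t -> riso r t.
Proof.
move=> /risoP[f fB fE] /risoP[g gB gE]; apply/risoP.
by exists (g \o f) => [|u v /=]; [exact: bij_comp | rewrite gE fE].
Qed.

Definition rsum V W (r : rel V) (s : rel W) : rel (V + W) := fun x y =>
  match x, y with
  | inl a, inl b => r a b
  | inr a, inr b => s a b
  | _, _ => false
  end.

Definition fsum (A B C D : Type) (f : A -> C) (g : B -> D) (x : A + B) : C + D :=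
  match x with inl a => inl (f a) | inr b => inr (g b) end.

Lemma riso_sum V V' W W' (r : rel V) (r' : rel V') (s : rel W) (s' : rel W') :
  riso r r' -> riso s s' -> riso (rsum r s) (rsum r' s').
Proof.
move=> /risoP[f [f' fK f'K] fE] /risoP[g [g' gK g'K] gE]; apply/risoP.
exists (fsum f g); last by case=> u [] v /=.
by exists (fsum f' g'); case=> x /=; rewrite ?fK ?f'K ?gK ?g'K.
Qed.

Lemma riso_sumC V W (r : rel V) (s : rel W) : riso (rsum r s) (rsum s r).
Proof.
pose h A B (x : A + B) := match x with inl a => inr a | inr b => inl b end.
apply/risoP; exists (@h V W); last by case=> u [] v.
by exists (@h W V); case.
Qed.

Lemma riso_sumA V W X (r : rel V) (s : rel W) (t : rel X) :
  riso (rsum r (rsum s t)) (rsum (rsum r s) t).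
Proof.
pose h (x : V + (W + X)) : (V + W) + X := match x with
  | inl a => inl (inl a) | inr (inl b) => inl (inr b) | inr (inr c) => inr c end.
pose k (x : (V + W) + X) : V + (W + X) := match x with
  | inl (inl a) => inl a | inl (inr b) => inr (inl b) | inr c => inr (inr c) end.
apply/risoP; exists h; last by case=> [u|[u|u]] [v|[v|v]].
by exists k; [case=> [|[]] | case=> [[]|]].
Qed.

Lemma riso_sum0 V (r : rel void) (s : rel V) : riso (rsum r s) s.
Proof.
pose h (x : void + V) : V := match x with inl a => match a with end | inr b => b end.
apply/risoP; exists h; last by case=> [[]|u] [[]|v].
by exists inr; [case=> [[]|] |].
Qed.

Lemma riso_void_sum V W (r : rel V) (s : rel W) (t : rel void) :
  riso (rsum r s) t -> #|V| = 0 /\ #|W| = 0.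
Proof.
case/risoP => f fB _; have := bij_eq_card fB.
by rewrite card_sum card_void => /eqP; rewrite addn_eq0 => /andP[/eqP ? /eqP ?].
Qed.

Lemma riso_void V (r : rel V) (t : rel void) : #|V| = 0 -> riso r t.
Proof.
move=> V0; have absV (x : V) : False by have := fintype0 x; rewrite V0; apply.
apply/risoP; exists (fun x => match absV x with end); last by move=> u; case: (absV u).
by exists (fun x : void => match x with end); [move=> u; case: (absV u) | case].
Qed.

Lemma riso_ext V (r s : rel V) : r =2 s -> riso r s.
Proof. by move=> rs; apply/risoP; exists id => [|u v]; [exists id | rewrite rs]. Qed.

End RelIso.


Record graph (V : finType) := Graph {
  edges : {set {set V}};
  edges_card2 : [forall e in edges, #|e| == 2] }.

HB.instance Definition _ (V : finType) := [isSub for @edges V].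
HB.instance Definition _ (V : finType) := [Finite of graph V by <:].

Record digraph (V : finType) := Digraph {
  arcs : {set V * V};
  arcs_irr : [forall x, (x, x) \notin arcs] }.

HB.instance Definition _ (V : finType) := [isSub for @arcs V].
HB.instance Definition _ (V : finType) := [Finite of digraph V by <:].

Definition adj (V : finType) (G : graph V) : rel V :=
  fun x y => [set x; y] \in edges G.

Definition arc (V : finType) (G : digraph V) : rel V :=
  fun x y => (x, y) \in arcs G.

Lemma adjxx (V : finType) (G : graph V) x : adj G x x = false.
Proof.
apply/negP => xE; move/forall_inP: (edges_card2 G) => /(_ _ xE).
by rewrite setUid cards1.
Qed.

Lemma arcxx (V : finType) (G : digraph V) x : arc G x x = false.
Proof. by apply/negbTE; move/forallP: (arcs_irr G); apply. Qed.

Lemma arc_inj (V : finType) (G H : digraph V) : arc G =2 arc H -> G = H.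
Proof. by move=> GH; apply/val_inj/setP => -[x y]; apply: GH. Qed.

Lemma adj_inj (V : finType) (G H : graph V) : adj G =2 adj H -> G = H.
Proof.
move=> GH; apply/val_inj/setP => e /=.
have [/cards2P[x [y [_ ->]]]|eN2] := boolP (#|e| == 2); first exact: GH.
have eN (L : graph V) : e \in edges L = false.
  by apply: contraNF eN2 => eL; move/forall_inP: (edges_card2 L); apply.
by rewrite !eN.
Qed.

Section Graphs.
Implicit Types V W : finType.

Fact induced_subproof V (G : graph V) (I : {set V}) :
  [forall e in [set e : {set {x : V | x \in I}} | val @: e \in edges G], #|e| == 2].
Proof.
apply/forall_inP => e; rewrite inE => eE.
by rewrite -(card_imset _ val_inj); move/forall_inP: (edges_card2 G); apply.
Qed.

Definition induced V (G : graph V) (I : {set V}) : graph {x : V | x \in I} :=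
  Graph (induced_subproof G I).

Lemma adj_induced V (G : graph V) (I : {set V}) x y :
  adj (induced G I) x y = adj G (val x) (val y).
Proof. by rewrite /adj inE imsetU1 imset_set1. Qed.

Fact dunion_subproof V W (G : graph V) (H : graph W) :
  [forall e in [set (@inl V W) @: (e : {set V}) | e in edges G]
           :|: [set (@inr V W) @: (e : {set W}) | e in edges H], #|e| == 2].
Proof.
apply/forall_inP => e; rewrite inE => /orP[] /imsetP[e' e'E ->];
  rewrite card_imset; try by move=> ? ? [].
  by move/forall_inP: (edges_card2 G); apply.
by move/forall_inP: (edges_card2 H); apply.
Qed.

Definition dunion V W (G : graph V) (H : graph W) : graph (V + W)%type :=
  Graph (dunion_subproof G H).

Lemma adj_dunion V W (G : graph V) (H : graph W) :
  adj (dunion G H) =2 rsum (adj G) (adj H).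
Proof.
have inlI : injective (@inl V W) by move=> ? ? [].
have inrI : injective (@inr V W) by move=> ? ? [].
have eLR (e : {set V}) (x : W) : inr x \notin inl @: e by apply/imsetP => -[].
have eRL (e : {set W}) (x : V) : inl x \notin inr @: e by apply/imsetP => -[].
have E2l (x y : V) : [set inl x; inl y] = (@inl V W) @: [set x; y].
  by rewrite imsetU1 imset_set1.
have E2r (x y : W) : [set inr x; inr y] = (@inr V W) @: [set x; y].
  by rewrite imsetU1 imset_set1.
rewrite /adj => -[] x [] y; rewrite inE /=.
- rewrite E2l (mem_imset _ _ (imset_inj inlI)).
  rewrite orbC; case: imsetP => // -[e _ E]; move: (set21 (@inl V W x) (inl y)).
  by rewrite E2l E (negbTE (eRL _ _)).
- apply/norP; split; apply/imsetP => -[e _ E].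
    by move: (set22 (@inl V W x) (inr y)); rewrite E (negbTE (eLR _ _)).
  by move: (set21 (@inl V W x) (inr y)); rewrite E (negbTE (eRL _ _)).
- apply/norP; split; apply/imsetP => -[e _ E].
    by move: (set21 (@inr V W x) (inl y)); rewrite E (negbTE (eLR _ _)).
  by move: (set22 (@inr V W x) (inl y)); rewrite E (negbTE (eRL _ _)).
rewrite E2r (mem_imset _ _ (imset_inj inrI)).
case: imsetP => // -[e _ E]; move: (set21 (@inr V W x) (inr y)).
by rewrite E2r E (negbTE (eLR _ _)).
Qed.

Fact no_edges_subproof : [forall e in (set0 : {set {set void}}), #|e| == 2].
Proof. by apply/forall_inP => e; rewrite inE. Qed.

Definition graph0 : graph void := Graph no_edges_subproof.

Fact relabel_subproof V (G : graph V) :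
  [forall e in [set enum_rank @: (e : {set V}) | e in edges G], #|e| == 2].
Proof.
apply/forall_inP => e /imsetP[e' e'E ->]; rewrite (card_imset _ enum_rank_inj).
by move/forall_inP: (edges_card2 G); apply.
Qed.

Definition relabel V (G : graph V) : graph 'I_#|V| := Graph (relabel_subproof G).

Lemma adj_relabel V (G : graph V) x y :
  adj (relabel G) (enum_rank x) (enum_rank y) = adj G x y.
Proof.
by rewrite /adj -(imset_set1 enum_rank y) -imsetU1 (mem_imset _ _ (imset_inj enum_rank_inj)).
Qed.

Fact diinduced_subproof V (G : digraph V) (I : {set V}) :
  [forall x, (x, x) \notin
     [set p : {x : V | x \in I} * {x : V | x \in I} | (val p.1, val p.2) \in arcs G]].
Proof. by apply/forallP => x; rewrite inE -[_ \in _]/(arc _ _ _) arcxx. Qed.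

Definition diinduced V (G : digraph V) (I : {set V}) : digraph {x : V | x \in I} :=
  Digraph (diinduced_subproof G I).

Lemma arc_diinduced V (G : digraph V) (I : {set V}) x y :
  arc (diinduced G I) x y = arc G (val x) (val y).
Proof. by rewrite /arc inE. Qed.

Fact didunion_subproof V W (G : digraph V) (H : digraph W) :
  [forall x, (x, x) \notin [set (@inl V W p.1, @inl V W p.2) | p in arcs G]
                       :|: [set (@inr V W p.1, @inr V W p.2) | p in arcs H]].
Proof.
apply/forallP => x; rewrite inE; apply/norP; split;
  apply/imsetP => -[[a b] abE [-> []]] // ab; move: abE; rewrite ab /=.
  by rewrite -[_ \in _]/(arc _ _ _) arcxx.
by rewrite -[_ \in _]/(arc _ _ _) arcxx.
Qed.

Definition didunion V W (G : digraph V) (H : digraph W) : digraph (V + W)%type :=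
  Digraph (didunion_subproof G H).

Lemma arc_didunion V W (G : digraph V) (H : digraph W) :
  arc (didunion G H) =2 rsum (arc G) (arc H).
Proof.
rewrite /arc => -[] x [] y; rewrite inE /=.
- apply/orP/idP => [[] /imsetP[[a b] abE] // [-> ->] //|xyE].
  by left; apply/imsetP; exists (x, y).
- by apply/orP => -[] /imsetP[[a b] abE].
- by apply/orP => -[] /imsetP[[a b] abE].
apply/orP/idP => [[] /imsetP[[a b] abE] // [-> ->] //|xyE].
by right; apply/imsetP; exists (x, y).
Qed.

Fact no_arcs_subproof : [forall x, (x, x) \notin (set0 : {set void * void})].
Proof. by apply/forallP => x; rewrite inE. Qed.

Definition digraph0 : digraph void := Digraph no_arcs_subproof.

Fact direlabel_subproof V (G : digraph V) :
  [forall x, (x, x) \notin [set (enum_rank p.1, enum_rank p.2) | p in arcs G]].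
Proof.
apply/forallP => x; apply/imsetP => -[[a b] abE [-> /enum_rank_inj ab]].
by move: abE; rewrite ab /= -[_ \in _]/(arc _ _ _) arcxx.
Qed.

Definition direlabel V (G : digraph V) : digraph 'I_#|V| :=
  Digraph (direlabel_subproof G).

Lemma arc_direlabel V (G : digraph V) x y :
  arc (direlabel G) (enum_rank x) (enum_rank y) = arc G x y.
Proof.
rewrite /arc; apply/imsetP/idP => [[[a b] abE [/enum_rank_inj-> /enum_rank_inj->]]|xyE] //.
by exists (x, y).
Qed.

End Graphs.


(** Graphs on arbitrary finite sets do not form a type on which one can take a
    free module; since every finite graph is isomorphic to one on ['I_n],
    isoclasses are taken among the latter, and [gcls] sends a graph on any
    finite type to its isoclass (see [gclsP]). *)

Definition ord_graph := {n : nat & graph 'I_n}.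
Definition ord_digraph := {n : nat & digraph 'I_n}.

Definition giso (G H : ord_graph) := riso (adj (tagged G)) (adj (tagged H)).
Definition diso (G H : ord_digraph) := riso (arc (tagged G)) (arc (tagged H)).

Fact giso_equiv : equiv_class_of giso.
Proof.
by split=> [G|G H|G H L]; [exact: riso_refl|exact: riso_sym|exact: riso_trans].
Qed.
Canonical giso_equiv_rel := EquivRelPack giso_equiv.

Fact diso_equiv : equiv_class_of diso.
Proof.
by split=> [G|G H|G H L]; [exact: riso_refl|exact: riso_sym|exact: riso_trans].
Qed.
Canonical diso_equiv_rel := EquivRelPack diso_equiv.

Definition gclass := {eq_quot giso}.
HB.instance Definition _ := Choice.on gclass.

Definition dclass := {eq_quot diso}.
HB.instance Definition _ := Choice.on dclass.

Definition gcls (V : finType) (G : graph V) : gclass :=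
  \pi_gclass (Tagged (fun n => graph 'I_n) (relabel G)).

Definition dcls (V : finType) (G : digraph V) : dclass :=
  \pi_dclass (Tagged (fun n => digraph 'I_n) (direlabel G)).

Section Classes.
Implicit Types V W : finType.

Lemma riso_relabel V (G : graph V) : riso (adj (relabel G)) (adj G).
Proof.
rewrite riso_sym; apply/risoP; exists enum_rank; last exact: adj_relabel.
exact: enum_rank_bij.
Qed.

Lemma riso_direlabel V (G : digraph V) : riso (arc (direlabel G)) (arc G).
Proof.
rewrite riso_sym; apply/risoP; exists enum_rank; last exact: arc_direlabel.
exact: enum_rank_bij.
Qed.

Lemma gclsE V W (G : graph V) (H : graph W) :
  (gcls G == gcls H) = riso (adj G) (adj H).
Proof.
rewrite /gcls piE /giso /=; apply/idP/idP => GH.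
  apply: riso_trans (riso_relabel H); apply: riso_trans GH.
  by rewrite riso_sym riso_relabel.
apply: riso_trans (riso_relabel G) _; apply: riso_trans GH _.
by rewrite riso_sym riso_relabel.
Qed.

Lemma dclsE V W (G : digraph V) (H : digraph W) :
  (dcls G == dcls H) = riso (arc G) (arc H).
Proof.
rewrite /dcls piE /diso /=; apply/idP/idP => GH.
  apply: riso_trans (riso_direlabel H); apply: riso_trans GH.
  by rewrite riso_sym riso_direlabel.
apply: riso_trans (riso_direlabel G) _; apply: riso_trans GH _.
by rewrite riso_sym riso_direlabel.
Qed.

Lemma gclsP V W (G : graph V) (H : graph W) :
  gcls G = gcls H <->
  exists2 f : V -> W, bijective f &
    forall u v, ([set f u; f v] \in edges H) = ([set u; v] \in edges G).
Proof.
split=> [/eqP|GH]; first by rewrite gclsE => /risoP.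
by apply/eqP; rewrite gclsE; apply/(risoP (adj G) (adj H)).
Qed.

Lemma dclsP V W (G : digraph V) (H : digraph W) :
  dcls G = dcls H <->
  exists2 f : V -> W, bijective f &
    forall u v, ((f u, f v) \in arcs H) = ((u, v) \in arcs G).
Proof.
split=> [/eqP|GH]; first by rewrite dclsE => /risoP.
by apply/eqP; rewrite dclsE; apply/(risoP (arc G) (arc H)).
Qed.

Definition grepr (c : gclass) : graph 'I_(tag (repr c)) := tagged (repr c).
Definition drepr (c : dclass) : digraph 'I_(tag (repr c)) := tagged (repr c).

Lemma greprK c : gcls (grepr c) = c.
Proof.
rewrite -[RHS]reprK; apply/eqP; rewrite /gcls piE /giso /=.
exact: riso_relabel.
Qed.

Lemma dreprK c : dcls (drepr c) = c.
Proof.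
rewrite -[RHS]reprK; apply/eqP; rewrite /dcls piE /diso /=.
exact: riso_direlabel.
Qed.

Lemma grepr_iso V (G : graph V) : riso (adj (grepr (gcls G))) (adj G).
Proof. by rewrite -gclsE greprK. Qed.

Lemma drepr_iso V (G : digraph V) : riso (arc (drepr (dcls G))) (arc G).
Proof. by rewrite -dclsE dreprK. Qed.

Definition gunit : gclass := gcls graph0.
Definition gmul (c d : gclass) : gclass := gcls (dunion (grepr c) (grepr d)).

Definition dunit : dclass := dcls digraph0.
Definition dmul (c d : dclass) : dclass := dcls (didunion (drepr c) (drepr d)).

Lemma riso_dunion V W (G : graph V) (H : graph W) :
  riso (adj (dunion G H)) (rsum (adj G) (adj H)).
Proof. exact: riso_ext (adj_dunion G H). Qed.

Lemma riso_didunion V W (G : digraph V) (H : digraph W) :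
  riso (arc (didunion G H)) (rsum (arc G) (arc H)).
Proof. exact: riso_ext (arc_didunion G H). Qed.

Lemma gmulE V W (G : graph V) (H : graph W) :
  gmul (gcls G) (gcls H) = gcls (dunion G H).
Proof.
apply/eqP; rewrite gclsE; apply: riso_trans (riso_dunion _ _) _.
apply: riso_trans (riso_sum (grepr_iso G) (grepr_iso H)) _.
by rewrite riso_sym riso_dunion.
Qed.

Lemma dmulE V W (G : digraph V) (H : digraph W) :
  dmul (dcls G) (dcls H) = dcls (didunion G H).
Proof.
apply/eqP; rewrite dclsE; apply: riso_trans (riso_didunion _ _) _.
apply: riso_trans (riso_sum (drepr_iso G) (drepr_iso H)) _.
by rewrite riso_sym riso_didunion.
Qed.

Lemma gmulC : commutative gmul.
Proof.
move=> c d; rewrite -[c]greprK -[d]greprK !gmulE; apply/eqP; rewrite gclsE.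
apply: riso_trans (riso_dunion _ _) _; apply: riso_trans (riso_sumC _ _) _.
by rewrite riso_sym riso_dunion.
Qed.

Lemma dmulC : commutative dmul.
Proof.
move=> c d; rewrite -[c]dreprK -[d]dreprK !dmulE; apply/eqP; rewrite dclsE.
apply: riso_trans (riso_didunion _ _) _; apply: riso_trans (riso_sumC _ _) _.
by rewrite riso_sym riso_didunion.
Qed.

Lemma gmulA : associative gmul.
Proof.
move=> c d e; rewrite -[c]greprK -[d]greprK -[e]greprK !gmulE; apply/eqP.
rewrite gclsE; apply: riso_trans (riso_dunion _ _) _.
apply: riso_trans (riso_sum (riso_refl _) (riso_dunion _ _)) _.
apply: riso_trans (riso_sumA _ _ _) _; rewrite riso_sym.
apply: riso_trans (riso_dunion _ _) _.
exact: riso_sum (riso_dunion _ _) (riso_refl _).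
Qed.

Lemma dmulA : associative dmul.
Proof.
move=> c d e; rewrite -[c]dreprK -[d]dreprK -[e]dreprK !dmulE; apply/eqP.
rewrite dclsE; apply: riso_trans (riso_didunion _ _) _.
apply: riso_trans (riso_sum (riso_refl _) (riso_didunion _ _)) _.
apply: riso_trans (riso_sumA _ _ _) _; rewrite riso_sym.
apply: riso_trans (riso_didunion _ _) _.
exact: riso_sum (riso_didunion _ _) (riso_refl _).
Qed.

Lemma gmul1 : left_id gunit gmul.
Proof.
move=> c; rewrite -[c]greprK gmulE; apply/eqP; rewrite gclsE.
exact: riso_trans (riso_dunion _ _) (riso_sum0 _ _).
Qed.

Lemma dmul1 : left_id dunit dmul.
Proof.
move=> c; rewrite -[c]dreprK dmulE; apply/eqP; rewrite dclsE.
exact: riso_trans (riso_didunion _ _) (riso_sum0 _ _).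
Qed.

Lemma gmul1r : right_id gunit gmul.
Proof. by move=> c; rewrite gmulC gmul1. Qed.

Lemma dmul1r : right_id dunit dmul.
Proof. by move=> c; rewrite dmulC dmul1. Qed.

Lemma gmul_unit c d : gmul c d = gunit -> c = gunit /\ d = gunit.
Proof.
rewrite -[c]greprK -[d]greprK gmulE => /eqP; rewrite gclsE riso_sym => cd.
have [c0 d0] : _ /\ _ := riso_void_sum (riso_symW (riso_trans cd (riso_dunion _ _))).
by split; apply/eqP; rewrite gclsE riso_void.
Qed.

Lemma dmul_unit c d : dmul c d = dunit -> c = dunit /\ d = dunit.
Proof.
rewrite -[c]dreprK -[d]dreprK dmulE => /eqP; rewrite dclsE riso_sym => cd.
have [c0 d0] : _ /\ _ := riso_void_sum (riso_symW (riso_trans cd (riso_didunion _ _))).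
by split; apply/eqP; rewrite dclsE riso_void.
Qed.

End Classes.

HB.instance Definition _ :=
  Choice_isMonomialDef.Build gclass gmulA gmul1 gmul1r gmul_unit.
HB.instance Definition _ := MonomialDef_isConomialDef.Build gclass gmulC.

HB.instance Definition _ :=
  Choice_isMonomialDef.Build dclass dmulA dmul1 dmul1r dmul_unit.
HB.instance Definition _ := MonomialDef_isConomialDef.Build dclass dmulC.


Section FreeModules.
Variable K : fieldType.

Definition lext (A : choiceType) (M : lmodType K) (f : A -> M)
    (x : {malg K[A]}) : M :=
  \sum_(a <- msupp x) x@_a *: f a.

Section LinearExtension.
Variables (A : choiceType) (M : lmodType K) (f : A -> M).

Lemma lextEw (d : {fset A}) (x : {malg K[A]}) :
  (msupp x `<=` d)%fset -> lext f x = \sum_(a <- d) x@_a *: f a.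
Proof.
move=> le; rewrite [LHS](big_fset_incl _ le) => //= a _ /mcoeff_outdom ->.
by rewrite scale0r.
Qed.

Lemma lextU a : lext f << a >> = f a.
Proof. by rewrite (lextEw msuppU_le) big_seq_fset1 mcoeffUU scale1r. Qed.

Lemma lext_is_linear : linear (lext f).
Proof.
move=> k x y; pose d := (msupp x `|` msupp y)%fset.
have le : (msupp (k *: x + y) `<=` d)%fset.
  by apply: fsubset_trans (msuppD_le _ _) _; rewrite fsetSU ?msuppZ_le.
rewrite (lextEw le) (@lextEw d x) ?fsubsetUl // (@lextEw d y) ?fsubsetUr //.
rewrite scaler_sumr -big_split /=; apply: eq_bigr => a _.
by rewrite mcoeffD mcoeffZ scalerDl scalerA.
Qed.

HB.instance Definition _ :=
  GRing.isLinear.Build K {malg K[A]} M *:%R (lext f) lext_is_linear.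

End LinearExtension.

(** [K[A] ⊗ K[B]] is realised as [K[A * B]], with [a ⊗ b] the basis element
    [(a, b)]. *)

Definition tens (A B : choiceType) (x : {malg K[A]}) (y : {malg K[B]}) :
    {malg K[(A * B)%type]} :=
  \sum_(a <- msupp x) \sum_(b <- msupp y) << x@_a * y@_b *g (a, b) >>.

Lemma tens_lext (A B : choiceType) (x : {malg K[A]}) (y : {malg K[B]}) :
  tens x y = lext (fun a => lext (fun b => << (a, b) >>) y) x.
Proof.
apply: eq_bigr => a _; rewrite scaler_sumr; apply: eq_bigr => b _.
by apply/malgP => c; rewrite !mcoeffZ !mcoeffU !mulrnAr mulr1.
Qed.

Definition tmap (A B C D : choiceType) (f : {malg K[A]} -> {malg K[C]})
    (g : {malg K[B]} -> {malg K[D]}) : {malg K[(A * B)%type]} -> {malg K[(C * D)%type]} :=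
  lext (fun p => tens (f << p.1 >>) (g << p.2 >>)).

Lemma tensU (A B : choiceType) (a : A) (b : B) : tens << a >> << b >> = << (a, b) >>.
Proof. by rewrite tens_lext !lextU. Qed.

Lemma linear_lext (A : choiceType) (M N : lmodType K) (g : {linear M -> N})
    (h : A -> M) x : g (lext h x) = lext (g \o h) x.
Proof. by rewrite linear_sum; apply: eq_bigr => a _; rewrite linearZ. Qed.

Lemma lext_id (A : choiceType) (x : {malg K[A]}) : x = lext (fun a => << a >>) x.
Proof.
rewrite {1}[x]monalgE; apply: eq_bigr => a _.
by apply/malgP => b; rewrite mcoeffZ !mcoeffU mulrnAr mulr1.
Qed.

Lemma tens_lextr (A B : choiceType) (x : {malg K[A]}) (y : {malg K[B]}) :
  tens x y = lext (fun b => lext (fun a => << (a, b) >>) x) y.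
Proof.
rewrite /tens exchange_big; apply: eq_bigr => b _; rewrite scaler_sumr.
apply: eq_bigr => a _.
by apply/malgP => c; rewrite !mcoeffZ !mcoeffU !mulrnAr mulr1 mulrC.
Qed.

Lemma tmap_tens (A B C D : choiceType)
    (f : {linear {malg K[A]} -> {malg K[C]}}) (g : {linear {malg K[B]} -> {malg K[D]}})
    x y :
  tmap f g (tens x y) = tens (f x) (g y).
Proof.
have -> : f x = lext (f \o (fun a => << a >>)) x by rewrite -linear_lext -lext_id.
have -> : g y = lext (g \o (fun b => << b >>)) y by rewrite -linear_lext -lext_id.
rewrite tens_lext /tmap linear_lext [RHS]tens_lext linear_lext.
apply: eq_bigr => a _; congr (_ *: _) => /=; rewrite linear_lext -[RHS]tens_lext.
rewrite [RHS]tens_lextr linear_lext; apply: eq_bigr => b _; congr (_ *: _) => /=.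
by rewrite lextU -[RHS]tens_lextr.
Qed.

(** The bialgebras below are monoid algebras [K[M]] (with the product of the
    monoid [M] extended bilinearly), given a coproduct and a counit. *)

Definition bialgebra_morphism (A B : monomType)
    (DeltaA : {malg K[A]} -> {malg K[(A * A)%type]}) (epsA : {malg K[A]} -> K)
    (DeltaB : {malg K[B]} -> {malg K[(B * B)%type]}) (epsB : {malg K[B]} -> K)
    (f : {malg K[A]} -> {malg K[B]}) : Prop :=
  [/\ linear f,
      f 1 = 1,
      {morph f : x y / x * y},
      forall x, DeltaB (f x) = tmap f f (DeltaA x)
    & forall x, epsB (f x) = epsA x].

End FreeModules.


Definition ideals (V : finType) (G : digraph V) : {set {set V}} :=
  [set I : {set V} | [forall x in I, forall y, ((x, y) \in arcs G) ==> (y \in I)]].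

Definition orientations (V : finType) (G : graph V) : {set digraph V} :=
  [set H : digraph V | [forall u, forall v,
     if [set u; v] \in edges G then ((u, v) \in arcs H) (+) ((v, u) \in arcs H)
     else (u, v) \notin arcs H]].

Section Structure.
Variable K : fieldType.
Implicit Types V W : finType.

Definition graph_coproduct V (G : graph V) : {malg K[(gclass * gclass)%type]} :=
  \sum_(I : {set V}) << (gcls (induced G I), gcls (induced G (~: I))) >>.

Definition digraph_coproduct V (G : digraph V) : {malg K[(dclass * dclass)%type]} :=
  \sum_(I in ideals G) << (dcls (diinduced G I), dcls (diinduced G (~: I))) >>.

Definition orientation_sum V (G : graph V) : {malg K[dclass]} :=
  \sum_(H in orientations G) << dcls H >>.

Definition DeltaG : {malg K[gclass]} -> {malg K[(gclass * gclass)%type]} :=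
  lext (fun c => graph_coproduct (grepr c)).

Definition epsG : {malg K[gclass]} -> K :=
  lext (fun c => (c == gcls graph0)%:R : K^o).

Definition DeltaGo : {malg K[dclass]} -> {malg K[(dclass * dclass)%type]} :=
  lext (fun c => digraph_coproduct (drepr c)).

Definition epsGo : {malg K[dclass]} -> K :=
  lext (fun c => (c == dcls digraph0)%:R : K^o).

Definition Theta : {malg K[gclass]} -> {malg K[dclass]} :=
  lext (fun c => orientation_sum (grepr c)).

(** These maps do not depend on the representatives chosen by [grepr], [drepr]. *)

Lemma induced_iso V W (G : graph V) (H : graph W) (f : V -> W) (I : {set V}) :
  bijective f -> (forall u v, adj H (f u) (f v) = adj G u v) ->
  riso (adj (induced G I)) (adj (induced H (f @: I))).
Proof.
move=> fB fE; apply/risoP.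
have fI (x : {x | x \in I}) : f (val x) \in f @: I by rewrite imset_f ?(valP x).
exists (fun x => Sub (f (val x)) (fI x)); last first.
  by move=> u v; rewrite !adj_induced !SubK fE.
apply: inj_card_bij.
  by move=> x y /(congr1 val) /(bij_inj fB) /val_inj.
by rewrite !card_sig card_imset //; exact: bij_inj.
Qed.

Lemma diinduced_iso V W (G : digraph V) (H : digraph W) (f : V -> W) (I : {set V}) :
  bijective f -> (forall u v, arc H (f u) (f v) = arc G u v) ->
  riso (arc (diinduced G I)) (arc (diinduced H (f @: I))).
Proof.
move=> fB fE; apply/risoP.
have fI (x : {x | x \in I}) : f (val x) \in f @: I by rewrite imset_f ?(valP x).
exists (fun x => Sub (f (val x)) (fI x)); last first.
  by move=> u v; rewrite !arc_diinduced !SubK fE.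
apply: inj_card_bij.
  by move=> x y /(congr1 val) /(bij_inj fB) /val_inj.
by rewrite !card_sig card_imset //; exact: bij_inj.
Qed.

Lemma imset_bij V W (f : V -> W) :
  bijective f -> bijective (fun I : {set V} => f @: I).
Proof.
case=> g fK gK; exists (fun J : {set W} => g @: J) => I; rewrite -imset_comp.
  by rewrite (eq_imset _ fK) imset_id.
by rewrite (eq_imset _ gK) imset_id.
Qed.

Lemma imset_bijC V W (f : V -> W) (I : {set V}) :
  bijective f -> ~: (f @: I) = f @: (~: I).
Proof.
move=> fB; have fI := bij_inj fB; case: (fB) => g fK gK; apply/setP => y.
by rewrite -[y]gK !inE !mem_imset // inE.
Qed.

Lemma graph_coproduct_iso V W (G : graph V) (H : graph W) :
  gcls G = gcls H -> graph_coproduct G = graph_coproduct H.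
Proof.
case/gclsP => f fB fE; rewrite /graph_coproduct.
rewrite [RHS](reindex (fun I : {set V} => f @: I)) /=; last first.
  exact: onW_bij (imset_bij fB).
apply: eq_bigr => I _; congr << (_, _) >>; apply/eqP; rewrite gclsE.
  exact: induced_iso.
by rewrite imset_bijC //; apply: induced_iso.
Qed.

Lemma digraph_coproduct_iso V W (G : digraph V) (H : digraph W) :
  dcls G = dcls H -> digraph_coproduct G = digraph_coproduct H.
Proof.
case/dclsP => f fB fE; rewrite /digraph_coproduct.
rewrite [RHS](reindex (fun I : {set V} => f @: I)) /=; last first.
  exact: onW_bij (imset_bij fB).
have fI := bij_inj fB.
apply: eq_big => I; last first.
  move=> _; congr << (_, _) >>; apply/eqP; rewrite dclsE.
    exact: diinduced_iso.
  by rewrite imset_bijC //; apply: diinduced_iso.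
case: (fB) => g fK gK; rewrite !inE; apply/forall_inP/forall_inP => GI.
  move=> _ /imsetP[x xI ->]; apply/forallP => y; rewrite -[y]gK fE mem_imset //.
  by move/forallP: (GI x xI).
move=> x xI; apply/forallP => y; move/forallP: (GI _ (imset_f f xI)) => /(_ (f y)).
by rewrite fE mem_imset.
Qed.

Fact ditransport_subproof V W (f : V -> W) (fI : injective f) (G : digraph V) :
  [forall x, (x, x) \notin [set (f p.1, f p.2) | p in arcs G]].
Proof.
apply/forallP => x; apply/imsetP => -[[a b] abE [-> /fI ab]].
by move: abE; rewrite ab /= -[_ \in _]/(arc _ _ _) arcxx.
Qed.

Definition ditransport V W (f : V -> W) (fI : injective f) (G : digraph V) : digraph W :=
  Digraph (ditransport_subproof fI G).

Lemma arc_ditransport V W (f : V -> W) (fI : injective f) (G : digraph V) u v :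
  arc (ditransport fI G) (f u) (f v) = arc G u v.
Proof.
rewrite /arc; apply/imsetP/idP => [[[a b] abE [/fI-> /fI->]]|uvE] //.
by exists (u, v).
Qed.

Lemma orientation_sum_iso V W (G : graph V) (H : graph W) :
  gcls G = gcls H -> orientation_sum G = orientation_sum H.
Proof.
case/gclsP => f fB fE; case: (fB) => g fK gK.
have fI := bij_inj fB; have gI := can_inj gK.
rewrite /orientation_sum [RHS](reindex (ditransport fI)) /=; last first.
  exists (ditransport gI) => L _; apply: arc_inj => x y.
    by rewrite -[x]fK -[y]fK !arc_ditransport !fK.
  by rewrite -[x]gK -[y]gK !arc_ditransport !gK.
apply: eq_big => L; last first.
  move=> _; congr << _ >>; apply/eqP; rewrite dclsE; apply/risoP.
  by exists f => // u v; rewrite arc_ditransport.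
rewrite !inE; apply/forallP/forallP => GL u; apply/forallP => v.
  rewrite -[u]gK -[v]gK fE -![_ \in arcs (ditransport _ _)]/(arc _ _ _) !arc_ditransport.
  by move/forallP: (GL (g u)).
move/forallP: (GL (f u)) => /(_ (f v)).
by rewrite fE -![_ \in arcs (ditransport _ _)]/(arc _ _ _) !arc_ditransport.
Qed.

Lemma DeltaG_gcls V (G : graph V) : DeltaG << gcls G >> = graph_coproduct G.
Proof. by rewrite /DeltaG lextU; apply: graph_coproduct_iso; rewrite greprK. Qed.

Lemma DeltaGo_dcls V (G : digraph V) : DeltaGo << dcls G >> = digraph_coproduct G.
Proof. by rewrite /DeltaGo lextU; apply: digraph_coproduct_iso; rewrite dreprK. Qed.

Lemma Theta_gcls V (G : graph V) :
  Theta << gcls G >> = \sum_(H in orientations G) << dcls H >>.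
Proof. by rewrite /Theta lextU; apply: orientation_sum_iso; rewrite greprK. Qed.

Lemma epsG_gcls V (G : graph V) : epsG << gcls G >> = (#|V| == 0)%:R.
Proof.
rewrite /epsG lextU gclsE; congr (_ %:R); congr nat_of_bool; apply/idP/eqP.
  by case/risoP => f /bij_eq_card; rewrite card_void.
by move=> V0; apply: riso_void.
Qed.

Lemma epsGo_dcls V (G : digraph V) : epsGo << dcls G >> = (#|V| == 0)%:R.
Proof.
rewrite /epsGo lextU dclsE; congr (_ %:R); congr nat_of_bool; apply/idP/eqP.
  by case/risoP => f /bij_eq_card; rewrite card_void.
by move=> V0; apply: riso_void.
Qed.

Lemma mul_gcls V W (G : graph V) (H : graph W) :
  << gcls G >> * << gcls H >> = << gcls (dunion G H) >> :> {malg K[gclass]}.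
Proof. by rewrite malgM_def fgmulUU mulr1 -gmulE. Qed.

Lemma mul_dcls V W (G : digraph V) (H : digraph W) :
  << dcls G >> * << dcls H >> = << dcls (didunion G H) >> :> {malg K[dclass]}.
Proof. by rewrite malgM_def fgmulUU mulr1 -dmulE. Qed.

End Structure.

(* Main.v *)
From HB Require Import structures.
From mathcomp Require Import all_boot all_order all_algebra.
From mathcomp Require Import finmap monalg.
Require Import Defs.

Set Implicit Arguments.
Unset Strict Implicit.

Import GRing.Theory.
Local Open Scope ring_scope.

(** All the conditions are linear in each argument, so they are checked on
    isoclasses of graphs. The heart of the matter is one bijection. Let the
    vertex set of [G] be split into two parts [A] and [B]. An orientation of [G]
    with no arc from [A] to [B] has its cross edges all oriented from [B] to
    [A], hence it amounts to a pair of independent orientations of the subgraphs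
    of [G] induced on [A] and on [B] ([sum_orientations_split]).

    - Coproduct: for a fixed set [I] of vertices, the orientations with no arc
      from [I] to its complement are exactly those of which [I] is an ideal;
      exchanging the sums over the orientations [H] of [G] and over the ideals
      [I] of [H] turns the coproduct of [Theta G] into the sum over [I] of
      the tensors [Theta G|I (x) Theta G|~I].
    - Product: in a disjoint union there is no cross edge at all, so the
      orientations of [G H] are the disjoint unions of an orientation of [G]
      and an orientation of [H].
    - Unit and counit: an empty graph has exactly one orientation, and an
      orientation has as many vertices as the graph. *)

(** * Linear maps on free modules *)

Section Linearity.
Variable K : fieldType.

(** A linear map on the span of the isoclasses is determined by its values on
    the classes of graphs on ordinals. *)
Lemma eq_linear_gcls (M : lmodType K) (f g : {malg K[gclass]} -> M) :
    linear f -> linear g ->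
    (forall n (G : graph 'I_n), f << gcls G >> = g << gcls G >>) -> f =1 g.
Proof.
move=> fL gL fg x.
pose f' : {linear _ -> _} := HB.pack f (GRing.isLinear.Build _ _ _ _ f fL).
pose g' : {linear _ -> _} := HB.pack g (GRing.isLinear.Build _ _ _ _ g gL).
rewrite -[f x]/(f' x) -[g x]/(g' x) [x]lext_id !linear_lext.
by apply: eq_bigr => c _ /=; rewrite -(greprK c) fg.
Qed.

Lemma linear_comp_lext (A : choiceType) (M N : lmodType K)
    (h : A -> M) (g : M -> N) : linear g -> linear (g \o lext h).
Proof. by move=> gL k x y /=; rewrite lext_is_linear gL. Qed.

Lemma tens_suml (A B : choiceType) I (r : seq I) (P : pred I)
    (F : I -> {malg K[A]}) (y : {malg K[B]}) :
  tens (\sum_(i <- r | P i) F i) y = \sum_(i <- r | P i) tens (F i) y.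
Proof.
by rewrite tens_lext linear_sum; apply: eq_bigr => i _; rewrite tens_lext.
Qed.

Lemma tens_sumr (A B : choiceType) I (r : seq I) (P : pred I)
    (x : {malg K[A]}) (F : I -> {malg K[B]}) :
  tens x (\sum_(i <- r | P i) F i) = \sum_(i <- r | P i) tens x (F i).
Proof.
by rewrite tens_lextr linear_sum; apply: eq_bigr => i _; rewrite tens_lextr.
Qed.

End Linearity.

(** * Splitting an orientation along a partition of the vertices *)

Section DigraphOf.
Variables (V : finType) (r : rel V) (r_irr : irreflexive r).

Fact digraph_of_subproof : [forall x, (x, x) \notin [set p | r p.1 p.2]].
Proof. by apply/forallP => x; rewrite inE /= r_irr. Qed.

(** The oriented graph whose arc relation is the irreflexive relation [r]. *)
Definition digraph_of : digraph V := Digraph digraph_of_subproof.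

Lemma arc_digraph_of x y : arc digraph_of x y = r x y.
Proof. by rewrite /arc inE. Qed.

End DigraphOf.

Lemma orientationsP (V : finType) (G : graph V) (H : digraph V) :
  reflect (forall u v, if adj G u v then arc H u v (+) arc H v u
                       else ~~ arc H u v)
          (H \in orientations G).
Proof.
rewrite inE; apply: (iffP forallP) => [GH u v|GH u]; first by move/forallP: (GH u) => /(_ v).
by apply/forallP => v; apply: GH.
Qed.

Lemma adjC (V : finType) (G : graph V) u v : adj G u v = adj G v u.
Proof. by rewrite /adj setUC. Qed.

Section Pullback.
Variables (A V : finType) (f : A -> V) (H : digraph V).

Fact dipull_irr : irreflexive (fun a b => arc H (f a) (f b)).
Proof. by move=> a; rewrite arcxx. Qed.

(** The pullback of [H] along [f]; when [f] is injective it is the oriented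
    graph induced by [H] on the image of [f]. *)
Definition dipull : digraph A := digraph_of dipull_irr.

Lemma arc_dipull a b : arc dipull a b = arc H (f a) (f b).
Proof. exact: arc_digraph_of. Qed.

End Pullback.

Section Split.
Variables (A B V : finType) (h : A + B -> V) (k : V -> A + B).
Hypotheses (hK : cancel h k) (kK : cancel k h).
Variables (GA : graph A) (GB : graph B) (G : graph V).
Hypothesis adjA : forall a b, adj GA a b = adj G (h (inl a)) (h (inl b)).
Hypothesis adjB : forall a b, adj GB a b = adj G (h (inr a)) (h (inr b)).

Definition glue_rel (HA : digraph A) (HB : digraph B) : rel V := fun x y =>
  match k x, k y with
  | inl a, inl b => arc HA a b
  | inr a, inr b => arc HB a b
  | inr _, inl _ => adj G x y
  | inl _, inr _ => false
  end.

Fact glue_irr HA HB : irreflexive (glue_rel HA HB).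
Proof. by move=> x; rewrite /glue_rel; case: (k x) => a; rewrite arcxx. Qed.

(** [HA] and [HB] put together along [h], with all the edges of [G] between
    the two parts oriented from [B] to [A]. *)
Definition glue HA HB : digraph V := digraph_of (glue_irr HA HB).

(** No arc of [H] goes from the part [A] to the part [B]. *)
Definition downward (H : digraph V) :=
  [forall a, forall b, ~~ arc H (h (inl a)) (h (inr b))].

(** [dipull] on each part and [glue] are inverse bijections between the
    downward orientations of [G] and the pairs of orientations of [GA] and
    [GB]. *)
Lemma sum_orientations_split (M : zmodType) (F : digraph A -> digraph B -> M) :
  \sum_(H in orientations G | downward H)
     F (dipull (h \o inl) H) (dipull (h \o inr) H) =
  \sum_(HA in orientations GA) \sum_(HB in orientations GB) F HA HB.
Proof.
rewrite pair_big /=.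
rewrite (reindex_onto (fun p => glue p.1 p.2)
  (fun H => (dipull (h \o inl) H, dipull (h \o inr) H))) /=; last first.
  move=> H /andP[/orientationsP HG /forallP Hd]; apply: arc_inj => x y.
  rewrite arc_digraph_of -[x]kK -[y]kK /glue_rel !hK.
  case: (k x) (k y) => [a|b] [a'|b']; rewrite ?arc_dipull //.
    by apply/esym/negbTE; move/forallP: (Hd a).
  have /negbTE N : ~~ arc H (h (inl a')) (h (inr b)) by move/forallP: (Hd a') => /(_ b).
  by have := HG (h (inr b)) (h (inl a')); rewrite N addbF; case: adj => [->|/negbTE->].
have pullK HA HB : (dipull (h \o inl) (glue HA HB), dipull (h \o inr) (glue HA HB))
    = (HA, HB).
  by congr (_, _); apply: arc_inj => a b;
    rewrite arc_dipull arc_digraph_of /glue_rel /= !hK.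
apply: eq_big => [[HA HB]|[HA HB] _] /=; last by case: (pullK HA HB) => -> ->.
rewrite pullK eqxx andbT.
have -> : downward (glue HA HB).
  apply/forallP => a; apply/forallP => b.
  by rewrite arc_digraph_of /glue_rel !hK.
rewrite andbT; apply/orientationsP/andP => [HG|[/orientationsP HGA /orientationsP HGB] u v].
  split; apply/orientationsP => a b.
    by have := HG (h (inl a)) (h (inl b)); rewrite !arc_digraph_of /glue_rel !hK adjA.
  by have := HG (h (inr a)) (h (inr b)); rewrite !arc_digraph_of /glue_rel !hK adjB.
rewrite !arc_digraph_of -[u]kK -[v]kK /glue_rel !hK.
case: (k u) (k v) => [a|b] [a'|b'].
- by rewrite -adjA; apply: HGA.
- by rewrite adjC; case: adj.
- by case: adj.
- by rewrite -adjB; apply: HGB.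
Qed.

End Split.

(** * The compatibilities on a graph *)

Section OnGraphs.
Variable K : fieldType.
Implicit Types V W : finType.

Lemma Theta_dunion V W (G : graph V) (H : graph W) :
  @Theta K << gcls (dunion G H) >> = @Theta K << gcls G >> * @Theta K << gcls H >>.
Proof.
rewrite [LHS]Theta_gcls [X in X * _]Theta_gcls [X in _ * X]Theta_gcls.
rewrite big_distrlr /=.
under [RHS]eq_bigr => HA _ do under eq_bigr => HB _ do rewrite mul_dcls.
have adjl a b : adj G a b = adj (dunion G H) (id (inl a)) (id (inl b)).
  by rewrite adj_dunion.
have adjr a b : adj H a b = adj (dunion G H) (id (inr a)) (id (inr b)).
  by rewrite adj_dunion.
have idK : cancel (id : V + W -> V + W) id by [].
pose F (HA : digraph V) (HB : digraph W) : {malg K[dclass]} :=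
  << dcls (didunion HA HB) >>.
apply: etrans (sum_orientations_split idK idK adjl adjr F).
(* No edge crosses, so neither does any arc, in either direction. *)
have cross L (a : V) (b : W) : L \in orientations (dunion G H) ->
    (arc L (inl a) (inr b) = false) * (arc L (inr b) (inl a) = false).
  move=> /orientationsP LG; split; apply/negbTE.
    by have := LG (inl a) (inr b); rewrite adj_dunion.
  by have := LG (inr b) (inl a); rewrite adj_dunion.
apply: eq_big => [L|L LG].
  case LG : (L \in _) => //=; apply/esym/forallP => a; apply/forallP => b.
  by rewrite cross.
congr << dcls _ >>; apply: arc_inj => -[a|a] [b|b];
  by rewrite arc_didunion /= ?arc_dipull ?cross.
Qed.

(** The vertices of [G] as the disjoint sum of a set [I] and its complement. *)
Definition join_parts V (I : {set V}) (x : {x | x \in I} + {x | x \in ~: I}) : V :=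
  match x with inl a => val a | inr b => val b end.

Lemma join_parts_bij V (I : {set V}) : bijective (@join_parts V I).
Proof.
apply: inj_card_bij; last by rewrite card_sum !card_sig cardsC.
case=> [[a aI]|[a aI]] [[b bI]|[b bI]] /= E; try (by congr inl; apply: val_inj);
  try (by congr inr; apply: val_inj).
  by exfalso; have := bI; rewrite inE -E aI.
by exfalso; have := bI; have := aI; rewrite inE E => /negbTE->.
Qed.

Lemma downward_ideal V (H : digraph V) (I : {set V}) :
  downward (@join_parts V I) H = (I \in ideals H).
Proof.
rewrite inE; apply/forallP/forall_inP => [dH x xI|IH a].
  apply/forallP => y; apply/implyP => xy; apply: contraLR xy => yI.
  have yI' : y \in ~: I by rewrite inE.
  by move/forallP: (dH (Sub x xI)) => /(_ (Sub y yI')).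
apply/forallP => b; have := valP b; rewrite inE /=; apply: contra => ab.
by move/forallP: (IH _ (valP a)) => /(_ (val b)) /implyP; apply.
Qed.

Lemma DeltaGo_Theta_gcls V (G : graph V) :
  DeltaGo (@Theta K << gcls G >>) = tmap (@Theta K) (@Theta K) (@DeltaG K << gcls G >>).
Proof.
rewrite DeltaG_gcls /graph_coproduct [X in DeltaGo X]Theta_gcls.
rewrite /DeltaGo /tmap !linear_sum /=.
under eq_bigr => H _.
  rewrite -/(DeltaGo _) DeltaGo_dcls /digraph_coproduct.
over.
rewrite (exchange_big_dep predT) //=; apply: eq_bigr => I _.
rewrite lextU /= [X in tens X _]Theta_gcls [X in tens _ X]Theta_gcls tens_suml.
under [RHS]eq_bigr => HA _.
  rewrite tens_sumr; under eq_bigr => HB _ do rewrite tensU.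
over.
have [k hK kK] := join_parts_bij I.
pose F HA HB : {malg K[(dclass * dclass)%type]} := << (dcls HA, dcls HB) >>.
have adjl a b : adj (induced G I) a b =
    adj G (join_parts (inl a)) (join_parts (inl b)) by rewrite adj_induced.
have adjr a b : adj (induced G (~: I)) a b =
    adj G (join_parts (inr a)) (join_parts (inr b)) by rewrite adj_induced.
apply: etrans (sum_orientations_split hK kK adjl adjr (F _ _)).
apply: eq_big => [H|H _]; first by rewrite downward_ideal.
have [-> ->] : diinduced H I = dipull (@join_parts V I \o inl) H /\
    diinduced H (~: I) = dipull (@join_parts V I \o inr) H.
  by split; apply: arc_inj => a b; rewrite arc_diinduced arc_dipull.
by [].
Qed.

Lemma orientations_void V (G : graph V) (H : digraph V) :
  #|V| = 0%N -> orientations G = [set H].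
Proof.
move=> V0; have absV (x : V) : False by have := fintype0 x; rewrite V0; apply.
apply/setP => L; rewrite in_set1; have -> : L = H by apply: arc_inj => x; case: (absV x).
by rewrite eqxx; apply/orientationsP => x; case: (absV x).
Qed.

Lemma Theta_unit : @Theta K 1 = 1.
Proof.
rewrite -[1 in LHS]/(<< gcls graph0 >>) [LHS]Theta_gcls.
by rewrite (@orientations_void _ _ digraph0) ?card_void // big_set1.
Qed.

Lemma epsGo_Theta_gcls V (G : graph V) :
  epsGo (@Theta K << gcls G >>) = epsG << gcls G >>.
Proof.
rewrite epsG_gcls [X in epsGo X]Theta_gcls /epsGo linear_sum /=.
under eq_bigr => H _ do rewrite -/(epsGo _) epsGo_dcls.
have [V0|_] := eqVneq #|V| 0%N; last by rewrite big1.
have r_irr : irreflexive (fun _ _ : V => false) by [].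
by rewrite (@orientations_void _ _ (digraph_of r_irr)) // big_set1.
Qed.

End OnGraphs.

Unset Implicit Arguments.

Theorem proposition4p1 (K : fieldType) (charK : [pchar K] =i pred0) :
  bialgebra_morphism (@DeltaG K) (@epsG K) (@DeltaGo K) (@epsGo K) (@Theta K).
Proof.
have ThetaL : linear (@Theta K) by apply: lext_is_linear.
split=> //.
- exact: Theta_unit.
- move=> x y.
  apply: (@eq_linear_gcls _ _ (fun x => @Theta K (x * y)) (fun x => @Theta K x * @Theta K y)).
  + by move=> a u v; rewrite mulrDl -scalerAl ThetaL.
  + by move=> a u v; rewrite ThetaL mulrDl -scalerAl.
  move=> n G; apply: (@eq_linear_gcls _ _ (fun y => @Theta K (_ * y)) (fun y => _ * @Theta K y)).
  + by move=> a u v; rewrite mulrDr -scalerAr ThetaL.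
  + by move=> a u v; rewrite ThetaL mulrDr -scalerAr.
  by move=> m H; rewrite [X in Theta X = _]mul_gcls; exact: Theta_dunion.
- apply: eq_linear_gcls => [||n G]; last exact: DeltaGo_Theta_gcls.
    by apply: linear_comp_lext; apply: lext_is_linear.
  by apply: linear_comp_lext; apply: lext_is_linear.
apply: (@eq_linear_gcls _ K^o) => [||n G]; last exact: epsGo_Theta_gcls.
  by apply: (@linear_comp_lext _ _ _ K^o); apply: lext_is_linear.
exact: lext_is_linear.
Qed.
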